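(* For every connected graph $G$ the following assertions are equivalent: (i) The end space of $G$ is second countable. (ii) The end space of $G$ is separable. (iii) There is a countable end-faithful normal tree $T\subseteq G$. (iv) The end space of $G$ has a countable base that consists of basic open sets.
   Context: Graphs may be infinite of any cardinality. Countable means finite or countably infinite. A ray is a one-way infinite path. Two rays in $G$ are equivalent if no finite set of vertices separates them; the equivalence classes are the ends of $G$, and $\Omega(G)$ is the set of ends. For finite $X\subseteq V(G)$ and $\omega\in\Omega(G)$, $C(X,\omega)$ is the unique component of $G-X$ that contains a tail of every ray in $\omega$. The end space of $G$ is $\Omega(G)$ with the topology having as a basis all sets $\Omega(X,C)=\{\omega\in\Omega(G): C(X,\omega)=C\}$, with $X\subseteq V(G)$ finite and $C$ a component of $G-X$; these sets $\Omega(X,C)$ are the basic open sets. Second countable means having a countable base; separable means having a countable dense subset. The tree-order of a rooted tree $(T,r)$ is given by $u\le v$ if $u$ lies on the path $rTv$ in $T$. A rooted tree $T\subseteq G$ is normal in $G$ if the endvertices of every $T$-path in $G$ are comparable in the tree-order of $T$, where a $T$-path in $G$ is a non-trivial path that meets $T$ exactly in its endvertices. A normal tree need not be spanning. For a subgraph $H\subseteq G$, rays equivalent in $H$ are equivalent in $G$, so there is a natural map $\iota:\Omega(H)\to\Omega(G)$ sending each end of $H$ to the end of $G$ that contains it as a subset; $H$ is end-faithful if $\iota$ is a bijection. *)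

(* Defs.v *)
From HB Require Import structures.
From mathcomp Require Import all_boot.
From mathcomp Require Import boolp classical_sets functions cardinality.
From mathcomp Require Import topology.

Set Implicit Arguments.
Unset Strict Implicit.
Unset Printing Implicit Defensive.

Local Open Scope classical_set_scope.

(* A graph is a set of vertices and a set of edges drawn from a fixed universe
   V, so that subgraphs of a graph, and their rays and ends, live over the same
   universe. *)
Record sgraph (V : Type) := SGraph {
  verts : set V;
  edge : rel V;
  edge_sym : symmetric edge;
  edge_irr : irreflexive edge;
  edge_verts : forall u v, edge u v -> verts u }.

Lemma edge_verts_r (V : Type) (G : sgraph V) u v : edge G u v -> verts G v.
Proof. by rewrite edge_sym; apply: edge_verts. Qed.

Lemma sgraph_ext (V : Type) (G H : sgraph V) :
  verts G `<=` verts H -> subrel (edge G) (edge H) ->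
  verts H `<=` verts G -> subrel (edge H) (edge G) -> G = H.
Proof.
case: G => vG eG sG iG pG; case: H => vH eH sH iH pH /= vGH eGH vHG eHG.
have vE : vG = vH by apply/seteqP.
have eE : eG = eH.
  by apply/funext => u; apply/funext => v; apply/idP/idP; [apply: eGH|apply: eHG].
by subst vH eH; f_equal; apply: Prop_irrelevance.
Qed.

HB.instance Definition _ (V : Type) := gen_eqMixin (sgraph V).
HB.instance Definition _ (V : Type) := gen_choiceMixin (sgraph V).

Definition empty_graph (V : Type) : sgraph V.
Proof. by exists set0 (fun _ _ => false). Defined.

Definition subgraph (V : Type) (H G : sgraph V) :=
  verts H `<=` verts G /\ subrel (edge H) (edge G).

Lemma subgraph_trans (V : Type) (G H K : sgraph V) :
  subgraph G H -> subgraph H K -> subgraph G K.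
Proof.
by move=> [vGH eGH] [vHK eHK]; split=> [x /vGH /vHK|x y /eGH /eHK].
Qed.

Definition delete (V : Type) (G : sgraph V) (X : set V) : sgraph V.
Proof.
exists (verts G `\` X) (fun u v => [&& edge G u v, u \notin X & v \notin X]).
- by move=> u v; rewrite edge_sym [X in _ && X]andbC.
- by move=> u; rewrite edge_irr.
- move=> u v /and3P[uv /negP uX _]; split; first exact: edge_verts uv.
  by move=> Xu; apply/uX/mem_set.
Defined.

(* x :: p is the sequence of vertices of a path. *)
Definition is_path (V : choiceType) (G : sgraph V) (x : V) (p : seq V) :=
  [/\ verts G x, path (edge G) x p & uniq (x :: p)].

Definition linked (V : choiceType) (G : sgraph V) (x y : V) :=
  exists2 p, is_path G x p & last x p = y.

(* Connected graphs are nonempty. *)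
Definition gconnected (V : choiceType) (G : sgraph V) :=
  verts G !=set0 /\ forall x y, verts G x -> verts G y -> linked G x y.

Definition component (V : choiceType) (G C : sgraph V) :=
  [/\ subgraph C G, gconnected C &
      forall C', subgraph C' G -> gconnected C' -> subgraph C C' -> C' = C].

(* Rays are given by their vertices in order from the initial vertex. *)
Definition ray (V : Type) (G : sgraph V) (r : nat -> V) :=
  injective r /\ forall n, edge G (r n) (r n.+1).

Definition has_tail_in (V : Type) (C : sgraph V) (r : nat -> V) :=
  exists n, ray C (fun k => r (n + k)).

Definition separates (V : choiceType) (G : sgraph V) (X A B : set V) :=
  forall x p, is_path G x p -> A x -> B (last x p) ->
    exists2 z, z \in x :: p & X z.

Definition ray_equiv (V : choiceType) (G : sgraph V) (r s : nat -> V) :=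
  ~ exists X, [/\ X `<=` verts G, finite_set X &
                  separates G X (range r) (range s)].

Definition ray_class (V : choiceType) (G : sgraph V) (r : nat -> V) :=
  [set s | ray G s /\ ray_equiv G r s].

Record ends (V : choiceType) (G : sgraph V) := End {
  end_rays : set (nat -> V);
  end_raysP : exists2 r, ray G r & end_rays = ray_class G r }.

HB.instance Definition _ (V : choiceType) (G : sgraph V) := gen_eqMixin (ends G).
HB.instance Definition _ (V : choiceType) (G : sgraph V) :=
  gen_choiceMixin (ends G).

(* C(X, w), a component only for finite X; see end_compP and end_comp_eq. *)
Definition end_comp (V : choiceType) (G : sgraph V) (X : set V) (w : ends G) :
    sgraph V :=
  xget (empty_graph V)
    [set C | component (delete G X) C /\ forall r, end_rays w r -> has_tail_in C r].

(* Omega(X, C) *)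
Definition end_nbhd (V : choiceType) (G : sgraph V) (X : set V) (C : sgraph V) :
    set (ends G) :=
  [set w | end_comp X w = C].
Arguments end_nbhd {V} G X C.

Definition basic_open (V : choiceType) (G : sgraph V) : set (set (ends G)) :=
  [set U | exists X C, [/\ X `<=` verts G, finite_set X,
     component (delete G X) C & U = end_nbhd G X C]].
Arguments basic_open {V} G.

Section Reachability.
Variable V : choiceType.
Implicit Types (G H C : sgraph V) (r s : nat -> V) (X : set V).

Definition reach G x y :=
  exists p, [/\ verts G x, path (edge G) x p & last x p = y].

Lemma linkedP G x y : linked G x y <-> reach G x y.
Proof.
split=> [[p [Gx xp _] pE]|[p [Gx xp <-]]]; first by exists p.
by case: (shortenP xp) => q xq uq _; exists q.
Qed.

Lemma reach0 G x : verts G x -> reach G x x. Proof. by exists [::]. Qed.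

Lemma reach_trans G x y z : reach G x y -> reach G y z -> reach G x z.
Proof.
move=> [p [Gx xp <-]] [q [_ yq <-]]; exists (p ++ q).
by rewrite cat_path xp yq last_cat.
Qed.

Lemma reach1 G x y : edge G x y -> reach G x y.
Proof. by move=> xy; exists [:: y]; rewrite /= xy; split=> //; apply: edge_verts xy. Qed.

Lemma reach_ind G (P : V -> Prop) x y : reach G x y -> P x ->
  (forall u v, edge G u v -> P u -> P v) -> P y.
Proof.
move=> [p [_ xp <-]] Px Pe; elim: p x xp Px => //= v p IH x /andP[xv vp] Px.
by apply: IH vp _; apply: Pe Px.
Qed.

Lemma reach_vertsr G x y : reach G x y -> verts G y.
Proof.
move=> xy; have [p [Gx _ _]] := xy; apply: (@reach_ind G (verts G) x y xy) => // u v uv _.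
exact: edge_verts_r uv.
Qed.

Lemma reach_sym G x y : reach G x y -> reach G y x.
Proof.
move=> xy; have [p [Gx _ _]] := xy; apply: (@reach_ind G (reach G ^~ x) x y xy) => [|u v uv ux].
  exact: reach0.
by apply: reach_trans ux; apply: reach1; rewrite edge_sym.
Qed.

Lemma reach_sub G H x y : subgraph H G -> reach H x y -> reach G x y.
Proof.
move=> [vHG eHG] xy; have [p [Hx _ _]] := xy.
apply: (@reach_ind H (reach G x) x y xy) => [|u v /eHG uv xu]; first exact/reach0/vHG.
exact/(reach_trans xu)/reach1.
Qed.

Definition comp_at G (x : V) : sgraph V.
Proof.
exists [set y | reach G x y] (fun u v => edge G u v && `[< reach G x u >]).
- move=> u v; rewrite edge_sym; apply: andb_id2l => vu.
  apply/asboolP/asboolP => xu; apply: reach_trans xu _; apply: reach1 => //.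
  by rewrite edge_sym.
- by move=> u; rewrite edge_irr.
- by move=> u v /andP[_ /asboolP].
Defined.

Lemma comp_at_sub G x : subgraph (comp_at G x) G.
Proof. by split=> [y /reach_vertsr|u v /andP[]]. Qed.

Lemma comp_at_reach G x y : reach G x y -> reach (comp_at G x) x y.
Proof.
move=> xy; have [p [Gx _ _]] := xy.
suff [] : reach (comp_at G x) x y /\ reach G x y by [].
apply: (@reach_ind G (fun z => reach (comp_at G x) x z /\ reach G x z) x y xy) =>
  [|u v uv [xu xu']]; first by split; apply: reach0 => //; apply: reach0.
split; last exact/(reach_trans xu')/reach1.
by apply/(reach_trans xu)/reach1; rewrite /= uv; apply/asboolP.
Qed.

Lemma comp_at_connected G x : verts G x -> gconnected (comp_at G x).
Proof.
move=> Gx; split; first by exists x; apply: reach0.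
move=> y z /comp_at_reach/reach_sym yx /comp_at_reach xz.
exact/linkedP/(reach_trans yx).
Qed.

Lemma connected_sub_comp_at G C x : subgraph C G -> gconnected C -> verts C x ->
  subgraph C (comp_at G x).
Proof.
move=> CG [_ Cc] Cx.
have H y : verts C y -> reach G x y.
  by move=> Cy; apply: reach_sub CG _; apply/linkedP/Cc.
split=> [y /H//|u v uv /=]; apply/andP; split; first by case: CG => _; apply.
by apply/asboolP/H/(edge_verts uv).
Qed.

Lemma component_comp_at G C x : component G C -> verts C x -> C = comp_at G x.
Proof.
move=> [CG Cc Cmax] Cx; apply/esym/Cmax; first exact: comp_at_sub.
- by apply: comp_at_connected; case: CG => + _; apply.
- exact: connected_sub_comp_at.
Qed.

Lemma comp_at_component G x : verts G x -> component G (comp_at G x).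
Proof.
move=> Gx; split; [exact: comp_at_sub|exact: comp_at_connected|].
move=> C CG Cc xC.
have Cx : verts C x by case: xC => + _; apply; apply: reach0.
have [v e] := connected_sub_comp_at CG Cc Cx.
by case: xC => v' e'; apply: sgraph_ext.
Qed.

Lemma component_eq G C C' x :
  component G C -> component G C' -> verts C x -> verts C' x -> C = C'.
Proof.
by move=> c c' Cx C'x; rewrite (component_comp_at c Cx) (component_comp_at c' C'x).
Qed.

Lemma ray_vert G r n : ray G r -> verts G (r n).
Proof. by move=> [_ /(_ n) e]; apply: edge_verts e. Qed.

Lemma ray_reach G r n : ray G r -> reach G (r 0) (r n).
Proof.
move=> Gr; elim: n => [|n IH]; first exact/reach0/ray_vert.
by apply/(reach_trans IH)/reach1; case: Gr.
Qed.

Lemma ray_comp_at G r : ray G r -> ray (comp_at G (r 0)) r.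
Proof.
move=> Gr; split=> [|n /=]; first by case: Gr.
by apply/andP; split; [case: Gr|apply/asboolP/ray_reach].
Qed.

Lemma ray_sub G H r : subgraph H G -> ray H r -> ray G r.
Proof. by move=> [_ HG] [ir er]; split=> // n; apply/HG. Qed.

Lemma tail_in_sub C C' r : subgraph C C' -> has_tail_in C r -> has_tail_in C' r.
Proof. by move=> CC' [n Cr]; exists n; apply: ray_sub Cr. Qed.

Lemma tail_in_verts C r : has_tail_in C r ->
  exists n, forall k, n <= k -> verts C (r k).
Proof.
by move=> [n Cr]; exists n => k nk; have := ray_vert (k - n) Cr; rewrite subnKC.
Qed.

Lemma tail_in_eq G C C' r : component G C -> component G C' ->
  has_tail_in C r -> has_tail_in C' r -> C = C'.
Proof.
move=> cC cC' /tail_in_verts[n Cn] /tail_in_verts[m Cm].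
apply: (component_eq (x := r (maxn n m)) cC cC').
  by apply: Cn; apply: leq_maxl.
by apply: Cm; apply: leq_maxr.
Qed.

Lemma finite_nat_bound (A : set nat) : finite_set A ->
  exists n, forall k, n <= k -> ~ A k.
Proof.
case/finite_seqP => t ->; exists (\max_(i <- t) i).+1 => k + /= kt.
by rewrite ltnNge leq_bigmax_seq.
Qed.

Lemma ray_avoids G X r : finite_set X -> ray G r ->
  exists n, forall k, n <= k -> ~ X (r k).
Proof.
move=> fX [ir _]; apply: (finite_nat_bound (A := r @^-1` X)).
by apply: finite_preimage => // i j _ _ /ir.
Qed.

Lemma delete_sub G X : subgraph (delete G X) G.
Proof. by split=> [x []|u v /and3P[]]. Qed.

Lemma delete_edge G X u v : edge G u v -> ~ X u -> ~ X v ->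
  edge (delete G X) u v.
Proof. by move=> uv Xu Xv; rewrite /= uv !memNset. Qed.

Lemma ray_tail_comp G X r : finite_set X -> ray G r ->
  exists2 C, component (delete G X) C & has_tail_in C r.
Proof.
move=> fX Gr; have [n Xn] := ray_avoids fX Gr.
have tr : ray (delete G X) (fun k => r (n + k)).
  case: Gr => ir er; split=> [i j /ir /addnI//|k].
  by rewrite addnS; apply: delete_edge => //; apply: Xn; rewrite ?leqW ?leq_addr.
exists (comp_at (delete G X) (r (n + 0))).
  exact: comp_at_component (ray_vert 0 tr).
by exists n; apply: ray_comp_at tr.
Qed.

Lemma path_delete G X x p : path (edge G) x p ->
  (forall z, z \in x :: p -> ~ X z) -> path (edge (delete G X)) x p.
Proof.
elim: p x => //= y p IH x /andP[xy yp] Xp; apply/andP; split.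
  by apply: delete_edge => //; apply: Xp; rewrite !inE eqxx ?orbT.
by apply: IH => // z zp; apply: Xp; rewrite inE zp orbT.
Qed.

Lemma ray_equivP G r s : ray G r -> ray G s ->
  ray_equiv G r s <-> forall X, X `<=` verts G -> finite_set X ->
    exists C, [/\ component (delete G X) C, has_tail_in C r & has_tail_in C s].
Proof.
move=> Gr Gs; split=> [rs X XG fX|rs [X [XG fX sep]]].
- have [C cC [n Cr]] := ray_tail_comp fX Gr.
  have [D cD [m Ds]] := ray_tail_comp fX Gs.
  suff CD : C = D by exists C; split=> //; [exists n|exists m; rewrite CD].
  pose Y := X `|` (r @` `I_n `|` s @` `I_m).
  have fY : finite_set Y.
    by rewrite !finite_setU; do !split=> //; apply: finite_image; apply: finite_II.
  have YG : Y `<=` verts G.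
    by move=> x [/XG//|[[i _ <-]|[i _ <-]]]; apply: ray_vert.
  apply: contrapT => nCD; apply: rs; exists Y; split=> // x p [Gx xp _].
  move=> [i _ xE] [j _ yE]; apply: contrapT => nY; apply: nCD.
  have Yp z : z \in x :: p -> ~ Y z by move=> zp Yz; apply: nY; exists z.
  have ni : n <= i.
    rewrite leqNgt; apply/negP => lt; apply: (Yp x); rewrite ?mem_head//.
    by right; left; exists i.
  have mj : m <= j.
    rewrite leqNgt; apply/negP => lt; apply: (Yp (last x p)); rewrite ?mem_last//.
    by right; right; exists j.
  have Cx : verts C x by have := ray_vert (i - n) Cr; rewrite subnKC // xE.
  have Dy : verts D (last x p) by have := ray_vert (j - m) Ds; rewrite subnKC // yE.
  apply: (component_eq cC cD) Dy.
  rewrite (component_comp_at cC Cx); exists p; split=> //.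
  + by case: cC => -[+ _] _ _; apply.
  + by apply: path_delete => // z /Yp nYz Xz; apply: nYz; left.
- have [C [cC /tail_in_verts[n Cr] /tail_in_verts[m Cs]]] := rs X XG fX.
  have [_ Cconn] : gconnected C by case: cC.
  have [p [Cx xp up] pE] := Cconn _ _ (Cr _ (leqnn _)) (Cs _ (leqnn _)).
  have CG : subgraph C (delete G X) by case: cC.
  have pp : is_path G (r n) p.
    split=> //; first exact: ray_vert.
    by apply: sub_path xp => u v; case: (subgraph_trans CG (delete_sub G X)) => _; apply.
  have [|z zp Xz] := sep _ _ pp (imageT _ _).
    by rewrite pE; apply: imageT.
  have /(_ z) : forall z, z \in r n :: p -> verts C z.
    elim: (p) (r n) Cx xp {z zp Xz Cr Cs pE up pp} => [|y q IH] x Cx /=.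
      by move=> _ z; rewrite inE => /eqP->.
    move=> /andP[xy yq] z; rewrite inE => /orP[/eqP->//|].
    by apply: IH yq z; apply: edge_verts_r xy.
  by move=> /(_ zp) /(proj1 CG)[].
Qed.

Lemma ray_equiv_refl G r : ray G r -> ray_equiv G r r.
Proof.
move=> Gr; apply/ray_equivP => // X XG fX.
by have [C cC Cr] := ray_tail_comp fX Gr; exists C.
Qed.

Lemma ray_equiv_sym G r s : ray G r -> ray G s ->
  ray_equiv G r s -> ray_equiv G s r.
Proof.
move=> Gr Gs /ray_equivP rs; apply/ray_equivP => // X XG fX.
by have [//|//|C []] := rs _ _ X XG fX; exists C.
Qed.

Lemma ray_equiv_trans G r s t : ray G r -> ray G s -> ray G t ->
  ray_equiv G r s -> ray_equiv G s t -> ray_equiv G r t.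
Proof.
move=> Gr Gs Gt /ray_equivP rs /ray_equivP st; apply/ray_equivP => // X XG fX.
have [//|//|C [cC Cr Cs]] := rs _ _ X XG fX.
have [//|//|D [cD Ds Dt]] := st _ _ X XG fX.
by exists C; split=> //; rewrite (tail_in_eq cC cD Cs Ds).
Qed.

Lemma ray_equiv_sub G H r s : subgraph H G -> ray H r -> ray H s ->
  ray_equiv H r s -> ray_equiv G r s.
Proof.
move=> [vHG eHG] Hr Hs rs [X [XG fX sep]]; apply: rs.
exists (X `&` verts H); split; [by move=> ? []|exact: finite_setIl|].
move=> x p [Hx xp up] rx sy; have [|z zp Xz] := sep x p _ rx sy.
  by split=> //; [apply: vHG|apply: sub_path xp].
exists z => //; split=> //; move: zp; rewrite inE => /orP[/eqP->//|zp].
elim: p x xp zp {Hx up rx sy} => //= y p IH x /andP[xy yp].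
by rewrite inE => /orP[/eqP->|/(IH _ yp)//]; apply: edge_verts_r xy.
Qed.

Lemma end_ray G (w : ends G) r : end_rays w r -> ray G r.
Proof. by case: w => S [s _ SE] /=; rewrite SE => -[]. Qed.

Lemma end_nonempty G (w : ends G) : exists r, end_rays w r.
Proof.
case: w => S [s Gs SE] /=; rewrite SE; exists s.
by split=> //; apply: ray_equiv_refl.
Qed.

Lemma end_equiv G (w : ends G) r s : end_rays w r -> end_rays w s <-> ray G s /\ ray_equiv G r s.
Proof.
case: w => S [t Gt SE] /=; rewrite SE => -[Gr tr].
split=> -[Gs h]; split=> //; last exact: ray_equiv_trans h.
by apply: ray_equiv_trans h => //; apply: ray_equiv_sym.
Qed.

Lemma end_eq G (w w' : ends G) r : end_rays w r -> end_rays w' r -> w = w'.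
Proof.
move=> wr wr'.
have E : end_rays w = end_rays w'.
  by apply/seteqP; split=> s; rewrite ?(end_equiv s wr) ?(end_equiv s wr').
case: w w' E {wr wr'} => S pS [S' pS'] /= E.
by subst S'; f_equal; apply: Prop_irrelevance.
Qed.

Lemma delete_setI G X : delete G X = delete G (X `&` verts G).
Proof.
have XE u : verts G u -> (u \in X `&` verts G) = (u \in X).
  by move=> Gu; rewrite in_setI (mem_set Gu) andbT.
apply: sgraph_ext.
- by move=> x [Gx Xx]; split=> // -[].
- move=> u v /and3P[uv uX vX] /=; rewrite !XE ?uv ?uX //.
    exact: edge_verts_r uv.
  exact: edge_verts uv.
- by move=> x [Gx Xx]; split=> // Xx'; apply: Xx.
- move=> u v /and3P[uv]; rewrite !XE => [uX vX| |].
  + by rewrite /= uv uX.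
  + exact: edge_verts_r uv.
  + exact: edge_verts uv.
Qed.

Lemma end_comp_eq G X (w : ends G) C : component (delete G X) C ->
  (forall r, end_rays w r -> has_tail_in C r) -> end_comp X w = C.
Proof.
move=> cC wC; apply: xget_unique => // D [cD wD].
have [r wr] := end_nonempty w.
exact: (tail_in_eq cD cC (wD r wr) (wC r wr)).
Qed.

Lemma end_compP G X (w : ends G) : finite_set X ->
  component (delete G X) (end_comp X w) /\
  forall r, end_rays w r -> has_tail_in (end_comp X w) r.
Proof.
move=> fX; have [r wr] := end_nonempty w; have Gr := end_ray wr.
have [C cC Cr] := ray_tail_comp fX Gr.
suff wC : forall s, end_rays w s -> has_tail_in C s by rewrite (end_comp_eq cC wC).
move=> s /(end_equiv s wr)[Gs /(ray_equivP Gr Gs) rs].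
have [||D []] := rs (X `&` verts G).
- by move=> ? [].
- exact: finite_setIl.
- rewrite -delete_setI => cD Dr Ds.
  by rewrite (tail_in_eq cC cD Cr Dr).
Qed.

End Reachability.

Section EndSpace.
Variables (V : choiceType) (G : sgraph V).

Lemma basic_open_cover : \bigcup_(U in basic_open G) U = setT.
Proof.
apply/seteqP; split=> // w _.
have [cC _] := end_compP w (@finite_set0 V).
by exists (end_nbhd G set0 (end_comp set0 w)) => //; exists set0, (end_comp set0 w); split.
Qed.

Lemma basic_open_join (U1 U2 : set (ends G)) (w : ends G) :
  basic_open G U1 -> basic_open G U2 -> U1 w -> U2 w ->
  exists U, [/\ basic_open G U, U w & U `<=` U1 `&` U2].
Proof.
move=> [X1 [C1 [X1G f1 c1 ->]]] [X2 [C2 [X2G f2 c2 ->]]] w1 w2.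
have fX : finite_set (X1 `|` X2) by rewrite finite_setU.
pose C := end_comp (X1 `|` X2) w; have [cC wC] := end_compP w fX.
exists (end_nbhd G (X1 `|` X2) C); split=> //.
  by exists (X1 `|` X2), C; split=> // x [/X1G|/X2G].
have key Y D : finite_set Y -> Y `<=` X1 `|` X2 -> component (delete G Y) D ->
    end_comp Y w = D -> end_nbhd G (X1 `|` X2) C `<=` end_nbhd G Y D.
  move=> fY YX cD wD w' Cw'; apply: end_comp_eq => // r w'r.
  have [r0 wr0] := end_nonempty w.
  have [_ /(_ _ wr0)] := end_compP w fY; rewrite wD => /tail_in_verts[m Dm].
  have /tail_in_verts[n Cn] := wC _ wr0.
  have [CX Cc _] := cC.
  have sub : subgraph (delete G (X1 `|` X2)) (delete G Y).
    split=> [x [Gx nX]|u v /and3P[uv uX vX]]; first by split=> // /YX.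
    by apply: delete_edge => // /YX/mem_set; apply/negP.
  have [_ /(_ _ w'r)] := end_compP w' fX; rewrite Cw'; apply: tail_in_sub.
  rewrite (component_comp_at cD (Dm _ (leq_maxr n m))).
  apply: connected_sub_comp_at => //; first exact: subgraph_trans sub.
  exact/Cn/leq_maxl.
move=> w' Cw'; split.
  by apply: key Cw' => // x; left.
by apply: key Cw' => // x; right.
Qed.

HB.instance Definition _ :=
  @isBaseTopological.Build (ends G) (set (ends G)) (basic_open G) id
    basic_open_cover basic_open_join.

Lemma basic_open_basis : basis (basic_open G).
Proof.
split=> [U bU|w U].
  by exists [set U]; [move=> _ ->|rewrite bigcup_set1].
rewrite nbhsE => -[O [[D sD <-] [B DB Bw]] OU].
exists B; first by split=> //; apply: sD.
by move=> x Bx; apply: OU; exists B.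
Qed.

End EndSpace.

Definition separable (T : topologicalType) :=
  exists2 D : set T, countable D & dense D.

Section NaturalMap.
Variables (V : choiceType) (H G : sgraph V).

Lemma end_class_subproof (r : nat -> V) : ray G r ->
  exists2 s, ray G s & ray_class G r = ray_class G s.
Proof. by exists r. Qed.

Lemma end_map_subproof (HG : subgraph H G) (e : ends H) :
  exists w : ends G, end_rays e `<=` end_rays w.
Proof.
have [r er] := end_nonempty e; have Hr := end_ray er.
have Gr := ray_sub HG Hr.
exists (End (end_class_subproof Gr)) => s /(end_equiv s er)[Hs rs].
by split; [apply: ray_sub Hs|apply: ray_equiv_sub rs].
Qed.

Definition end_map (HG : subgraph H G) (e : ends H) : ends G :=
  projT1 (cid (end_map_subproof HG e)).

Lemma end_map_sub (HG : subgraph H G) (e : ends H) :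
  end_rays e `<=` end_rays (end_map HG e).
Proof. exact: projT2 (cid (end_map_subproof HG e)). Qed.

Lemma end_map_unique (HG : subgraph H G) (e : ends H) (w : ends G) :
  end_rays e `<=` end_rays w -> end_map HG e = w.
Proof.
by have [r er] := end_nonempty e => /(_ r er); apply/end_eq/end_map_sub.
Qed.

Definition end_faithful (HG : subgraph H G) := bijective (end_map HG).

End NaturalMap.

(* ucycle (edge G) c allows size c <= 2, which is not a cycle of a graph. *)
Definition acyclic (V : choiceType) (G : sgraph V) :=
  forall c, 2 < size c -> ~ ucycle (edge G) c.

Definition tree (V : choiceType) (T : sgraph V) := gconnected T /\ acyclic T.

Definition tree_le (V : choiceType) (T : sgraph V) (r u v : V) :=
  exists p, [/\ is_path T r p, last r p = v & u \in r :: p].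

(* The edges of T also count as T-paths here; their ends are always comparable. *)
Definition TPath (V : choiceType) (G T : sgraph V) (x : V) (p : seq V) :=
  [/\ is_path G x p, p != [::] &
      forall z, z \in x :: p -> verts T z <-> z = x \/ z = last x p].

Definition normal_tree (V : choiceType) (G T : sgraph V) (r : V) :=
  [/\ tree T, verts T r, subgraph T G &
      forall x p, TPath G T x p ->
        tree_le T r x (last x p) \/ tree_le T r (last x p) x].

(* Main.v *)
Require Import Defs.
From mathcomp Require Import all_boot.
From mathcomp Require Import boolp classical_sets functions cardinality.
From mathcomp Require Import topology.

(* Write [u] for the finite down-closure of a vertex u of a normal tree T with
   root r.  Deleting [u] from G puts the vertices of T above distinct children
   of u into distinct components.  So if w is an end of G in the closure of
   V(T), i.e. every C(Y, w) meets T, then following the components C([u], w)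
   upwards from the root yields a ray R of T.  A finite set X misses all of T
   above some vertex of R; what T has above that vertex is connected, lies in
   G - X, and contains all vertices of T in some C([u], w).  This gives R in w,
   the equivalence in T of any two T-rays in w, and, when T is end-faithful,
   that the sets Omega([u], C) with C meeting T form a base; there are only
   countably many of them if T is countable.
   Conversely, given a countable dense set of ends, take one ray in each; their
   countably many vertices lie in a countable normal tree, built by growing
   finite normal trees leaf by leaf along paths that start at the greatest
   neighbour of a component.  By density every end is then in the closure of
   this tree, which is therefore end-faithful. *)

Set Implicit Arguments.
Unset Strict Implicit.
Unset Printing Implicit Defensive.

Local Open Scope classical_set_scope.

(** * Paths in trees *)

Section Walks.
Variable V : choiceType.
Implicit Types (G H T : sgraph V) (X : set V).

Lemma path_verts G x p : verts G x -> path (edge G) x p ->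
  forall z, z \in x :: p -> verts G z.
Proof.
elim: p x => [|y p IH] x Gx /=; first by move=> _ z; rewrite inE => /eqP->.
move=> /andP[xy yp] z; rewrite inE => /orP[/eqP->//|].
by apply: IH yp z; apply: edge_verts_r xy.
Qed.

Lemma path_reach G x p z : verts G x -> path (edge G) x p -> z \in x :: p ->
  reach G x z.
Proof.
move=> Gx xp; rewrite inE => /orP[/eqP->|zp]; first exact: reach0.
move: xp; case/path.splitP: zp => p1 p2; rewrite cat_path => /andP[xp1 _].
by exists (rcons p1 z); rewrite last_rcons.
Qed.

Lemma is_path_sub G H x p : subgraph H G -> is_path H x p -> is_path G x p.
Proof. by move=> [HGv HGe] [/HGv Gx xp u]; split=> //; apply: sub_path xp. Qed.

Lemma reach_path G x y : reach G x y -> exists2 p, is_path G x p & last x p = y.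
Proof. by move/linkedP. Qed.

Lemma delete_subS G X Y : X `<=` Y -> subgraph (delete G Y) (delete G X).
Proof.
move=> XY; split=> [x [Gx nX]|u v /and3P[uv uX vX]]; first by split=> // /XY.
by apply: delete_edge => // /XY/mem_set; apply/negP.
Qed.

Lemma delete_subG G H X : subgraph H G -> subgraph (delete H X) (delete G X).
Proof.
move=> [vHG eHG]; split=> [x [/vHG Gx nX]//|u v /and3P[uv uX vX]].
by rewrite /= uX vX eHG.
Qed.

Lemma is_path_cat G x p q : is_path G x (p ++ q) ->
  is_path G x p /\ is_path G (last x p) q.
Proof.
move=> [Gx]; rewrite cat_path => /andP[xp pq].
have -> : x :: p ++ q = (x :: p) ++ q by [].
rewrite cat_uniq => /and3P[up /hasPn npq uq]; split; split=> //=.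
- exact: path_verts xp _ (mem_last x p).
- by rewrite uq andbT; apply/negP => /npq; rewrite mem_last.
Qed.

Lemma is_path_rcons G x p y : is_path G x p -> edge G (last x p) y ->
  y \notin x :: p -> is_path G x (rcons p y).
Proof.
move=> [Gx xp up] py nyp; split=> //; first by rewrite rcons_path xp.
by rewrite -rcons_cons rcons_uniq nyp.
Qed.

(* The two paths diverge at x; joining their tails outside x closes a cycle. *)
Lemma acyclic_path_inj G x p q : acyclic G ->
  is_path G x p -> is_path G x q -> last x p = last x q -> p = q.
Proof.
move=> acG; elim: p x q => [|a p IH] x [|b q] //.
- by move=> _ [_ _ /andP[/negP nq _]] /= e; case: nq; rewrite e mem_last.
- by move=> [_ _ /andP[/negP nq _]] _ /= e; case: nq; rewrite -e mem_last.
move=> ap bq /= e.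
have [ab|nab] := eqVneq a b.
  subst b; congr cons; apply: IH e.
    by have [] := @is_path_cat G x [:: a] p ap.
  by have [] := @is_path_cat G x [:: a] q bq.
case: ap => Gx /= /andP[xa pa] /andP[xp _].
case: bq => _ /= /andP[xb qb] /andP[xq _].
pose H := delete G [set x].
have walk c s : edge G x c -> path (edge G) c s -> x \notin c :: s ->
    reach H c (last c s).
  move=> xc cs xs; apply: (@path_reach H c s); last exact: mem_last.
    split; first exact: edge_verts_r xc.
    by move=> cx; rewrite -cx mem_head in xs.
  by apply: path_delete => // z zs zx; rewrite -zx zs in xs.
have ab : reach H a b.
  apply: reach_trans (walk _ _ xa pa xp) _; rewrite e.
  exact/reach_sym/walk.
have [s [Ha as_ us] sb] := reach_path ab.
have nxs : x \notin a :: s.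
  by apply/negP => /(path_verts Ha as_)[_]; apply.
exfalso; apply: (acG (x :: a :: s)).
  by case: s sb {as_ us nxs} => //= eab; rewrite eab eqxx in nab.
rewrite /ucycle/ucycleb /= rcons_path xa sb [edge G b x]edge_sym xb andbT.
apply/andP; split; last by move: nxs us; rewrite /= => -> ->.
by apply: sub_path as_ => u v; case: (delete_sub G [set x]) => _; apply.
Qed.

End Walks.

(** Encodes a vertex by its path from the root, unique in a tree. The tree-order becomes the prefix
    order, and the down-closure of [v] consists of the entries of [r :: tpath T r v]. *)
Definition tpath (V : choiceType) (T : sgraph V) (r v : V) : seq V :=
  xget [::] [set p | is_path T r p /\ last r p = v].

Section RootedTree.
Variables (V : choiceType) (T : sgraph V) (r : V).
Hypotheses (treeT : tree T) (Tr : verts T r).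

Lemma tpathP v : verts T v -> is_path T r (tpath T r v) /\ last r (tpath T r v) = v.
Proof.
move=> Tv; have [[_ /(_ r v Tr Tv)[p rp pv]] _] := treeT.
by rewrite /tpath; case: xgetP => [q _ //|/(_ p)] /=; case.
Qed.

Lemma tpath_unique p : is_path T r p -> tpath T r (last r p) = p.
Proof.
move=> rp; have [Tr' rp' _] := rp.
have [|rq qE] := tpathP (v := last r p).
  exact: path_verts rp' _ (mem_last r p).
exact: (acyclic_path_inj treeT.2 rq rp qE).
Qed.

Lemma mem_tpath u v : verts T v -> u \in r :: tpath T r v ->
  prefix (tpath T r u) (tpath T r v).
Proof.
move=> Tv; have [+ _] := tpathP Tv.
rewrite inE => rp /orP[/eqP->|up].
  have -> : tpath T r r = [::] by apply: (@tpath_unique [::]); split.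
  exact: prefix0s.
move: rp; case/splitPr: up => p1 p2; rewrite -cat_rcons => /is_path_cat[rp1 _].
have := tpath_unique rp1; rewrite last_rcons => ->.
exact: prefix_prefix.
Qed.

Lemma tree_le_prefix u v : tree_le T r u v -> prefix (tpath T r u) (tpath T r v).
Proof.
move=> [p [rp pv up]]; have Tv : verts T v.
  by rewrite -pv; case: rp => _ rp _; apply: path_verts rp _ (mem_last r p).
by apply: mem_tpath => //; rewrite -pv tpath_unique.
Qed.

Lemma prefix_path p v : verts T v -> prefix p (tpath T r v) ->
  is_path T r p /\ verts T (last r p).
Proof.
move=> Tv /prefixP[q vE]; have [+ _] := tpathP Tv.
by rewrite vE => /is_path_cat[rp [Tp _ _]].
Qed.

(** From [last r p] on, the root path of [v] stays above [last r p], where [X] has no vertex. *)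
Lemma cone_reach p v X : verts T v -> prefix p (tpath T r v) ->
  (forall w, verts T w -> prefix p (tpath T r w) -> ~ X w) ->
  reach (delete T X) (last r p) v.
Proof.
move=> Tv pv nX; have [rp Tp] := prefix_path Tv pv.
have [rv vE] := tpathP Tv.
move/prefixP: pv => [q qE]; move: vE rv; rewrite qE last_cat => vE rv.
have nXq z : z \in last r p :: q -> ~ X z.
  move=> zq; have Tz : verts T z.
    by have [_ [_ pq _]] := is_path_cat rv; apply: path_verts zq.
  apply: nX => //; move: zq; rewrite inE => /orP[/eqP->|zq].
    by rewrite tpath_unique ?prefix_refl.
  move: rv; case/splitPr: zq => q1 q2.
  rewrite -cat_rcons catA => /is_path_cat[/tpath_unique + _].
  by rewrite last_cat last_rcons => ->; apply: prefix_prefix.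
rewrite -vE; apply: path_reach (mem_last _ _).
  by split=> //; apply: nXq; apply: mem_head.
by apply: path_delete => //; have [_ []] := is_path_cat rv.
Qed.

End RootedTree.

(** * Ends in the closure of a normal tree *)

Section EndComponents.
Variables (V : choiceType) (G : sgraph V) (w : ends G).
Implicit Types (X Y : set V).

Lemma end_comp_tail X s : finite_set X -> end_rays w s ->
  exists n, forall k, n <= k -> verts (end_comp X w) (s k).
Proof. by move=> fX ws; have [_ /(_ s ws)/tail_in_verts] := end_compP w fX. Qed.

Lemma end_comp_comp_at X x : finite_set X -> verts (end_comp X w) x ->
  end_comp X w = comp_at (delete G X) x.
Proof. by move=> fX; have [cC _] := end_compP w fX; apply: component_comp_at. Qed.

Lemma end_comp_reach X x y : finite_set X -> verts (end_comp X w) x ->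
  verts (end_comp X w) y <-> reach (delete G X) x y.
Proof. by move=> fX /(end_comp_comp_at fX)->. Qed.

Lemma end_comp_verts X x : finite_set X -> verts (end_comp X w) x ->
  verts G x /\ ~ X x.
Proof. by move=> fX; have [[[+ _] _ _] _] := end_compP w fX; apply. Qed.

(** A ray of [w] has a tail in both components, and a path that avoids [Y] also avoids [X]. *)
Lemma end_comp_anti X Y x : finite_set Y -> X `<=` Y ->
  verts (end_comp Y w) x -> verts (end_comp X w) x.
Proof.
move=> fY XY Cx; have fX := sub_finite_set XY fY.
have [s ws] := end_nonempty w.
have [n CX] := end_comp_tail fX ws; have [m CY] := end_comp_tail fY ws.
apply/(end_comp_reach x fX (CX _ (leq_maxl n m))).
apply: reach_sub (delete_subS G XY) _.
exact/(end_comp_reach x fY (CY _ (leq_maxr n m))).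
Qed.

End EndComponents.

Lemma end_comp_eq_cofinal (V : choiceType) (G : sgraph V) (w w' : ends G) X s :
  finite_set X -> end_rays w' s ->
  (forall m, exists2 k, m <= k & verts (end_comp X w) (s k)) ->
  end_comp X w' = end_comp X w.
Proof.
move=> fX w's Cs; have [m C's] := end_comp_tail fX w's; have [k mk Ck] := Cs m.
by rewrite (end_comp_comp_at fX (C's k mk)) (end_comp_comp_at fX Ck).
Qed.

Lemma finite_mem (V : choiceType) (s : seq V) : finite_set [set` s].
Proof. by apply/finite_seqP; exists s. Qed.

(** * Separation by down-closures in a normal tree *)

Section NormalTree.
Variables (V : choiceType) (G T : sgraph V) (r : V).
Hypothesis normT : normal_tree G T r.
Local Notation tp := (tpath T r).

(* By cone_reach the converse also holds: the vertices of T above a child c of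
   the end of p are those in one component of G - (r :: p). *)
Lemma cone_closed p c a b : verts T a -> verts T b ->
  prefix (rcons p c) (tp a) -> reach (delete G [set` r :: p]) a b ->
  prefix (rcons p c) (tp b).
Proof.
have [treeT Tr TG nT] := normT.
move=> Ta Tb + /reach_path[s]; elim: {s}_.+1 {-2}s (ltnSn (size s)) a Ta => // n IH.
move=> s sn a Ta pa [[Ga nXa] as_ us] sb.
have [s0|s0] := eqVneq s [::]; first by move: sb; rewrite s0 /= => <-.
pose inT z := `[< verts T z >].
have hasT : has inT s.
  apply/hasP; exists b; last exact/asboolP.
  case: s s0 sb {as_ us sn} => //= y s _ <-; exact: mem_last.
(* Cut the path at its first vertex [y] in [T] after [a]. The initial segment is a [T]-path, so [a]
   and [y] are comparable; induction on the length handles the rest. *)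
move: sn as_ us sb {s0}; case: (split_find hasT) => {hasT s} y s1 s2 /asboolP Ty nT1.
rewrite size_cat size_rcons cat_path last_cat last_rcons => sn /andP[as1 ys2].
rewrite -cat_cons cat_uniq => /and3P[us1 nus2 us2] sb.
have [Gy nXy] : verts (delete G [set` r :: p]) y.
  by apply: path_verts as1 _ _ => //; rewrite inE mem_rcons mem_head orbT.
have [dv de] := delete_sub G [set` r :: p].
have aTy : TPath G T a (rcons s1 y).
  split.
  - by split=> //; apply: sub_path as1.
  - by rewrite -size_eq0 size_rcons.
  - move=> z; rewrite last_rcons inE mem_rcons inE => zs.
    split=> [Tz|[->|->]//]; move: zs => /orP[/eqP|/orP[/eqP|zs1]]; [by left|by right|].
    by case/hasP: nT1; exists z => //; apply/asboolP.
apply: (IH s2 _ y Ty) => //.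
- by move: sn; rewrite addSn ltnS; apply: leq_ltn_trans; rewrite leq_addl.
- have := nT _ _ aTy; rewrite last_rcons => -[|] /(tree_le_prefix treeT Tr).
    exact: prefix_trans.
  (* Now [y] lies below [a], so [tp y] and [rcons p c] are both prefixes of [tp a]. Either [y] lies
     above [c], or it is one of the deleted vertices [r :: p]. *)
  move=> ya; move: (pa) (ya); rewrite !prefixE => /eqP pE /eqP yE.
  have [lt|gt] := leqP (size (rcons p c)) (size (tp y)).
    by rewrite -yE take_takel // pE.
  exfalso; apply: nXy => /=.
  have [_ <-] := tpathP treeT Tr Ty; rewrite size_rcons ltnS in gt.
  have -> : tp y = take (size (tp y)) p.
    rewrite -{1}yE -[in RHS](take_size_cat [:: c] (erefl (size p))) cats1 -pE.
    by rewrite !take_takel ?size_rcons ?leqW.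
  have := mem_last r (take (size (tp y)) p); rewrite !inE => /orP[->//|].
  by move=> /mem_take->; rewrite orbT.
- split=> //; rewrite /= us2 andbT; apply: contra nus2 => ys.
  by apply/hasP; exists y => //; rewrite inE mem_rcons mem_head orbT.
Qed.

(* w is in the closure of V(T) *)
Definition end_meets (w : ends G) := forall Y, Y `<=` verts G -> finite_set Y ->
  exists2 v, verts T v & verts (end_comp Y w) v.

(* p n is the path from the root to the n-th vertex of a ray of T. *)
Definition branch (w : ends G) (p : nat -> seq V) := forall n,
  [/\ size (p n) = n, is_path T r (p n), p n.+1 = rcons (p n) (last r (p n.+1)) &
      forall v, verts T v -> verts (end_comp [set` r :: p n] w) v ->
        prefix (p n.+1) (tp v)].

(** By [cone_closed], all vertices of [T] in the component of [w] beyond [r :: p] lie above a single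
    child of the end of [p]; that child is the next vertex. The invariant [I] is carried along, and
    [J p c] says that [c] is this child. *)
Lemma branch_exists w : end_meets w -> exists p, branch w p.
Proof.
have [treeT Tr TG nT] := normT; move=> mw.
pose I p := is_path T r p /\ forall v, verts T v ->
  verts (end_comp [set` r :: p] w) v -> prefix p (tp v).
pose J p c := is_path T r (rcons p c) /\ forall v, verts T v ->
  verts (end_comp [set` r :: p] w) v -> prefix (rcons p c) (tp v).
have fp p : finite_set [set` r :: p] by exact: finite_mem.
have JI p c : J p c -> I (rcons p c).
  move=> [pc ppc]; split=> // v Tv Cv; apply: ppc => //.
  apply: end_comp_anti Cv => // z /=; rewrite !inE mem_rcons inE => /orP[->//|->].
  by rewrite !orbT.
have step p : exists c, I p -> J p c.
  have [[rp ip]|nI] := pselect (I p); last by exists r.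
  have [|v Tv Cv] := mw [set` r :: p] _ (fp p).
    by move=> z zp; apply: (path_verts _ _ zp); have [] := is_path_sub TG rp.
  move/prefixP: (ip v Tv Cv) => [q vE].
  have [rv vl] := tpathP treeT Tr Tv.
  have [_ nv] := end_comp_verts (fp p) Cv.
  (* As [v] is not among the deleted vertices, its root path continues after [p], and its next
     vertex [c] is the child sought. *)
  case: q vE => [vE|c q vE].
    by case: nv; rewrite /= -vl vE cats0 mem_last.
  have pv : prefix (rcons p c) (tp v) by rewrite vE -cat_rcons prefix_prefix.
  exists c => _; split=> [|u Tu Cu]; first by case: (prefix_path treeT Tr Tv pv).
  by apply: (cone_closed Tv Tu pv); apply/(end_comp_reach _ (fp p) Cv).
have [f fP] := choice step.
pose p n := iter n (fun p => rcons p (f p)) [::].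
have Ip n : I (p n).
  elim: n => [|n IH]; first by split=> [//|v _ _]; exact: prefix0s.
  exact/JI/fP.
exists p => n; split.
- by elim: n => //= n; rewrite size_rcons => ->.
- by case: (Ip n).
- by rewrite /= last_rcons.
- by case: (fP (p n) (Ip n)).
Qed.

(** * The ray of the tree that follows an end *)

Section Branch.
Variables (w : ends G) (p : nat -> seq V).
Hypotheses (mw : end_meets w) (wp : branch w p).
Local Notation R := (fun n => last r (p n)).

Lemma branch_tpath n : tp (R n) = p n.
Proof. by have [treeT Tr _ _] := normT; have [_ /tpath_unique->] := wp n. Qed.

Lemma branch_verts n : verts T (R n).
Proof.
by have [_ [Tr rp _] _ _] := wp n; apply: path_verts rp _ (mem_last _ _).
Qed.

Lemma branch_prefix n m : n <= m -> prefix (p n) (p m).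
Proof.
move=> /subnKC<-; elim: (m - n) => [|k IH]; first by rewrite addn0 prefix_refl.
apply: prefix_trans IH _; have [_ _ + _] := wp (n + k); rewrite addnS => ->.
exact: prefix_rcons.
Qed.

Lemma branch_ray : ray T R.
Proof.
split=> [n m e|n].
  have /(congr1 size) := congr1 tp e; rewrite !branch_tpath.
  by have [-> _ _ _] := wp n; have [-> _ _ _] := wp m.
have [_ [_ + _] _ _] := wp n.+1; have [_ _ e _] := wp n.
by rewrite e rcons_path last_rcons => /andP[].
Qed.

(** Root paths that extend [p n] have length at least [n], while the lengths [size (tp x)] are
    bounded for [x] in the finite set [X]. *)
Lemma cone_avoids X : finite_set X ->
  exists n, forall v, verts T v -> prefix (p n) (tp v) -> ~ X v.
Proof.
move=> /finite_seqP[s ->]; exists (\max_(x <- s) size (tp x)).+1 => v Tv pv /= vs.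
have := size_prefix pv; have [-> _ _ _] := wp (\max_(x <- s) size (tp x)).+1.
by rewrite ltnNge (@leq_bigmax_seq _ s xpredT (fun x => size (tp x)) v vs isT).
Qed.

Definition branch_set n := [set` r :: p n].

Lemma branch_set_sub n : branch_set n `<=` verts G.
Proof.
have [_ _ TG _] := normT.
by have [_ /(is_path_sub TG)[Gr rp _] _ _] := wp n; apply: path_verts.
Qed.

(** The common core of the three main facts below. Choose [n] so that [X] misses everything above
    [R n]. A vertex of [T] in the component of [w] beyond [branch_set n] lies above [R n], as do all
    later [R m], and [cone_reach] joins them through [R n]. *)
Lemma branch_comp_reach X : finite_set X -> exists n, forall v m,
  verts T v -> verts (end_comp (branch_set n) w) v -> n < m ->
  reach (delete T X) v (R m).
Proof.
have [treeT Tr _ _] := normT.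
move=> fX; have [n nX] := cone_avoids fX; exists n => v m Tv Cv nm.
have H u : verts T u -> prefix (p n) (tp u) -> reach (delete T X) (R n) u.
  by move=> Tu pu; apply: cone_reach.
apply: reach_trans (reach_sym (H _ Tv _)) (H _ (branch_verts m) _).
  have [_ _ _ /(_ v Tv Cv)] := wp n.
  exact/prefix_trans/branch_prefix.
by rewrite branch_tpath branch_prefix // ltnW.
Qed.

(** Deleting [X] and [branch_set n] together leaves a vertex of [T] lying in both C(X, w) and the
    component of [w] beyond [branch_set n]. It is joined to a tail of [R] outside [X], so C(X, w)
    contains this tail. *)
Lemma branch_end : end_rays w R.
Proof.
have [_ _ TG _] := normT.
have [s ws] := end_nonempty w; apply/(end_equiv _ ws).
have GR := ray_sub TG branch_ray; split=> //.
apply/(ray_equivP (end_ray ws) GR) => X XG fX.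
have [cC wC] := end_compP w fX; exists (end_comp X w); split=> //; first exact: wC.
have [n nX] := branch_comp_reach fX.
have fY : finite_set (X `|` branch_set n).
  by rewrite finite_setU; split=> //; apply: finite_mem.
have [|v Tv Cv] := mw _ fY.
  by move=> z [/XG//|]; apply: branch_set_sub.
have CX : verts (end_comp X w) v by apply: end_comp_anti Cv => // z; left.
have CB : verts (end_comp (branch_set n) w) v.
  by apply: end_comp_anti Cv => // z; right.
have CR m : n < m -> verts (end_comp X w) (R m).
  move=> nm; apply/(end_comp_reach _ fX CX).
  exact/(reach_sub (delete_subG X TG))/nX.
have [D cD [m DR]] := ray_tail_comp fX GR.
suff -> : end_comp X w = D by exists m.
apply: (component_eq (x := R (m + n.+1)) cC cD).
  by apply: CR; rewrite addnS ltnS leq_addl.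
exact: (ray_vert n.+1 DR).
Qed.

(** A tail of [s] lies in the component of [w] beyond [branch_set n], so its vertices are joined to
    a tail of [R] inside [T] minus [X]. *)
Lemma branch_unique s : ray T s -> end_rays w s -> ray_equiv T R s.
Proof.
have [_ _ TG _] := normT.
move=> Ts ws; apply/(ray_equivP branch_ray Ts) => X XT fX.
have [n nX] := branch_comp_reach fX.
have [D cD [m DR]] := ray_tail_comp fX branch_ray.
have [C cC [l Cs]] := ray_tail_comp fX Ts.
exists D; split=> //; first by exists m.
suff -> : D = C by exists l.
have [k Ck] := end_comp_tail (finite_mem _ : finite_set (branch_set n)) ws.
rewrite (component_comp_at cC (ray_vert k Cs)).
rewrite (component_comp_at cD (ray_vert n.+1 DR)).
have /comp_at_component cE : verts (delete T X) (s (l + k)).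
  by case: cC => -[+ _] _ _; apply; apply: ray_vert Cs.
have e : reach (delete T X) (s (l + k)) (R (m + n.+1)).
  apply: nX; [exact: ray_vert|by apply: Ck; rewrite leq_addl|].
  by rewrite addnS ltnS leq_addl.
by rewrite -(component_comp_at cE e).
Qed.

End Branch.

(** Onto because the branch of [w] lies in [w]; injective because every ray of [T] in [w] is
    equivalent in [T] to that branch. *)
Lemma end_meets_faithful (TG : subgraph T G) :
  (forall w, end_meets w) -> end_faithful TG.
Proof.
move=> mw.
have surj w : exists e, end_map TG e = w.
  have [p wp] := branch_exists (mw w); have TR := branch_ray wp.
  have [e eR] : exists e : ends T, end_rays e (fun n => last r (p n)).
    exists (End (end_class_subproof TR)); split=> //.
    exact: ray_equiv_refl.
  by exists e; apply: (end_eq (end_map_sub TG eR)); apply: branch_end.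
have inj : injective (end_map TG).
  move=> e e' ee'; have [p wp] := branch_exists (mw (end_map TG e)).
  have [s es] := end_nonempty e; have [s' es'] := end_nonempty e'.
  have TR := branch_ray wp; have Ts := end_ray es; have Ts' := end_ray es'.
  have Rs := branch_unique wp Ts (end_map_sub TG es).
  have Rs' : ray_equiv T (fun n => last r (p n)) s'.
    by apply: branch_unique wp _ Ts' _; rewrite ee'; apply: end_map_sub.
  apply: (end_eq (r := s')) es'; apply/(end_equiv _ es); split=> //.
  by apply: ray_equiv_trans Rs' => //; apply: ray_equiv_sym.
have [g gP] := choice surj.
by exists g => // e; apply: inj; rewrite gP.
Qed.

(** * A base from an end-faithful normal tree *)

Lemma faithful_tree_ray (TG : subgraph T G) (w : ends G) :
  end_faithful TG -> exists2 s, ray T s & end_rays w s.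
Proof.
move=> [g _ gK]; have [s gs] := end_nonempty (g w).
by exists s; [exact: end_ray gs|rewrite -(gK w); apply: end_map_sub].
Qed.

Lemma faithful_end_meets (TG : subgraph T G) (w : ends G) :
  end_faithful TG -> end_meets w.
Proof.
move=> /(faithful_tree_ray w)[s Ts ws] Y _ fY.
have [n Cs] := end_comp_tail fY ws.
by exists (s n); [exact: ray_vert|exact: Cs].
Qed.

(** A pair of tree vertices codes a set: the first gives the down-closure to delete, the second
    selects a component. Thus only components meeting [T] occur, and countability is inherited from
    pairs of vertices. *)
Definition tree_base : set (set (ends G)) :=
  [set end_nbhd G [set` r :: tp x.1]
         (comp_at (delete G [set` r :: tp x.1]) x.2) | x in
   [set x | [/\ verts T x.1, verts T x.2 & ~ [set` r :: tp x.1] x.2]]].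

Lemma countable_tree_base : countable (verts T) -> countable tree_base.
Proof.
move=> cT; apply: sub_countable (card_image_le _ _) _.
apply: sub_countable (countableX cT cT).
by apply: subset_card_le => x [].
Qed.

Lemma tree_base_basic : tree_base `<=` basic_open G.
Proof.
have [treeT Tr TG _] := normT.
move=> _ [[u t] /= [Tu Tt nt] <-].
exists [set` r :: tp u], (comp_at (delete G [set` r :: tp u]) t); split=> //.
- have [/(is_path_sub TG)[Gr rp _] _] := tpathP treeT Tr Tu.
  exact: path_verts rp.
- by apply: comp_at_component; split=> //; apply: (proj1 TG).
Qed.

(** With [n] from [branch_comp_reach], any end [w'] having the same component as [w] beyond
    [r :: p n] contains a ray of [T]. A tail of that ray is joined to a tail of the branch of [w]
    outside [X], so C(X, w') = C(X, w). *)
Lemma tree_base_basis (TG : subgraph T G) : end_faithful TG -> basis tree_base.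
Proof.
move=> eT; have [bo bf] := basic_open_basis G.
split=> [U /tree_base_basic/bo//|w U /bf[_ [[X [C [XG fX cC ->]]] wC] CU]].
have mw := faithful_end_meets w eT.
have [p wp] := branch_exists mw; have wR := branch_end mw wp.
have [n nX] := branch_comp_reach wp fX.
have fB : finite_set [set` r :: p n] by exact: finite_mem.
have [m Cm] := end_comp_tail fB wR; have [l Cl] := end_comp_tail fX wR.
(* The vertex [t] of the branch selects the component of [w] in the coding of [tree_base]. *)
have := Cm m (leqnn m); set t := last r (p m) => Ct.
exists (end_nbhd G [set` r :: p n] (end_comp [set` r :: p n] w)).
  split=> //; exists (last r (p n), t); last first.
    by rewrite /= (branch_tpath wp) (end_comp_comp_at fB Ct).
  split=> /=; [exact: branch_verts wp _|exact: branch_verts wp _|].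
  by rewrite (branch_tpath wp); have [_] := end_comp_verts fB Ct.
move=> w' /= w'C; apply: CU; rewrite /end_nbhd /= in wC *; rewrite -wC.
have [s Ts w's] := faithful_tree_ray w' eT.
have [k Ck] := end_comp_tail fB w's; rewrite w'C in Ck.
apply: (end_comp_eq_cofinal fX w's) => i; exists (maxn i k); first exact: leq_maxl.
have nl : n < maxn n.+1 l by apply: leq_maxl.
apply/(end_comp_reach _ fX (Cl _ (leq_maxr n.+1 l))).
apply/reach_sym/(reach_sub (delete_subG X TG))/nX => //; first exact: ray_vert.
exact/Ck/leq_maxr.
Qed.

End NormalTree.

(** * Countable normal trees *)

Section AddLeaf.
Variables (V : choiceType) (T : sgraph V) (x y : V).
Hypotheses (Tx : verts T x) (Ty : ~ verts T y).

Definition add_leaf : sgraph V.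
Proof.
exists (y |` verts T)
  (fun u v => [|| edge T u v, (u == x) && (v == y) | (u == y) && (v == x)]).
- move=> u v; congr orb; first exact: edge_sym.
  by rewrite orbC; congr orb; apply: andbC.
- move=> u; rewrite edge_irr orFb [X in _ || X]andbC orbb.
  by apply/negP => /andP[/eqP-> /eqP xy]; apply: Ty; rewrite -xy.
- by move=> u v /or3P[uv|/andP[/eqP-> _]|/andP[/eqP-> _]];
    [right; exact: edge_verts uv|right|left].
Defined.

Lemma add_leaf_sub : subgraph T add_leaf.
Proof. by split=> [z|u v]; [right|rewrite /= => ->]. Qed.

Lemma add_leaf_nbr z : edge add_leaf y z -> z = x.
Proof.
move=> /or3P[/(@edge_verts _ T)//|/andP[/eqP yx]|/andP[_ /eqP//]].
by case: Ty; rewrite yx.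
Qed.

Lemma add_leaf_tree : tree T -> tree add_leaf.
Proof.
move=> [[_ cT] aT]; split.
  split; first by exists y; left.
  have H z : verts add_leaf z -> reach add_leaf x z.
    move=> [->|Tz]; first by apply: reach1; rewrite /= !eqxx orbT.
    by apply: reach_sub add_leaf_sub _; apply/linkedP/cT.
  move=> u v /H/reach_sym ux /H xv; exact/linkedP/(reach_trans ux).
move=> c c2 /andP[cc uc]; have [yc|nyc] := boolP (y \in c); last first.
  apply: (aT c) => //; rewrite /ucycle /ucycleb uc andbT.
  apply: (sub_in_cycle (P := predC1 y)) cc; last first.
    by apply/allP => z zc; apply: contraNneq nyc => <-.
  move=> u v /= uy vy /or3P[//|/andP[_ /eqP e]|/andP[/eqP e _]].
    by rewrite e !inE eqxx in vy.
  by rewrite e !inE eqxx in uy.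
(* Rotate the cycle to start at [y]: its second and last vertices are distinct, yet both are
   neighbours of [y] and hence equal to [x]. *)
have [i s cE] := rot_to yc.
rewrite -(rot_cycle i) cE in cc; rewrite -(rot_uniq i) cE in uc.
rewrite -(size_rot i) cE in c2.
case: s c2 {cE} cc uc => [//|a [//|b s]] _ /=.
move=> /and3P[/add_leaf_nbr -> _]; rewrite rcons_path => /andP[_ sy].
rewrite -(add_leaf_nbr (etrans (edge_sym add_leaf _ _) sy)) => /and3P[_ /negP nx _].
by case: nx; exact: mem_last.
Qed.

Lemma add_leaf_le r z : tree_le T r z x -> tree_le add_leaf r z y.
Proof.
move=> [p [rp px zp]]; exists (rcons p y); split.
- apply: is_path_rcons; rewrite ?px /= ?eqxx ?orbT //.
    exact: is_path_sub add_leaf_sub rp.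
  by apply/negP => yp; apply: Ty; case: rp => Tr rp _; apply: path_verts rp _ yp.
- by rewrite last_rcons.
- by move: zp; rewrite !inE mem_rcons inE => /orP[->//|->]; rewrite !orbT.
Qed.

End AddLeaf.

(** * Extending a finite normal tree to a given vertex *)

Section Extension.
Variables (V : choiceType) (G : sgraph V) (r : V).
Hypothesis connG : gconnected G.
Implicit Types T : sgraph V.

Lemma tree_le_sub T T' u v : subgraph T T' -> tree_le T r u v -> tree_le T' r u v.
Proof. by move=> TT' [p [/(is_path_sub TT') rp pv up]]; exists p. Qed.

Lemma TPath_rev T a p : TPath G T a p ->
  TPath G T (last a p) (rev (belast a p)) /\ last (last a p) (rev (belast a p)) = a.
Proof.
move=> [[Ga ap up] p0 Tp].
have rE : last a p :: rev (belast a p) = rev (a :: p).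
  by rewrite [a :: p]lastI rev_rcons.
have lE : last (last a p) (rev (belast a p)) = a.
  by case: p p0 {ap up Tp rE} => //= b p _; rewrite rev_cons last_rcons.
split=> //; split.
- split; first exact: path_verts ap _ (mem_last _ _).
    rewrite rev_path; apply: sub_path ap => u v; rewrite edge_sym; exact.
  by rewrite rE rev_uniq.
- by case: p p0 {ap up Tp rE lE} => //= b p _; rewrite rev_cons -size_eq0 size_rcons.
- move=> z; rewrite lE rE mem_rev => /Tp ->; tauto.
Qed.

(** The last hypothesis puts every neighbour in [T] of the component of [y] in [G] minus [T] below
    [x], hence below the new leaf. *)
Lemma add_leaf_normal T x y (Tx : verts T x) (Ty : ~ verts T y) :
  normal_tree G T r -> edge G x y ->
  (forall z w, verts T z -> reach (delete G (verts T)) y w -> edge G w z ->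
    tree_le T r z x) ->
  normal_tree G (add_leaf Tx Ty) r.
Proof.
move=> [tT Tr TG nT] xy Nx; have TL := add_leaf_sub Tx Ty.
have [TLv TLe] := TL.
split; [exact: add_leaf_tree|by right| |].
  split=> [z [->|]|u v /or3P[|/andP[/eqP-> /eqP->]//|/andP[/eqP-> /eqP->]]].
  - exact: edge_verts_r xy.
  - by case: TG => + _; apply.
  - by case: TG => _; apply.
  - by rewrite edge_sym.
(* Up to its last edge such a path runs outside [T], so [b] is a neighbour in [T] of the component
   of [y]. *)
have yb b p : TPath G (add_leaf Tx Ty) y p -> last y p = b ->
    tree_le (add_leaf Tx Ty) r b y.
  case/lastP: p => [[]//|p c] [[Gy + up] _ Lp]; rewrite last_rcons => + <-.
  rewrite rcons_path => /andP[yp pc]; move: Lp; rewrite last_rcons => Lp.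
  move: up; rewrite -rcons_cons rcons_uniq => /andP[cp up].
  apply/(add_leaf_le Tx Ty)/(Nx c (last y p)) => //.
    have [] : verts (add_leaf Tx Ty) c by apply/Lp; [rewrite inE mem_rcons mem_head orbT|right].
      by move=> e; rewrite e mem_head in cp.
    by [].
  apply: path_reach (mem_last _ _); first by split.
  apply: path_delete => // z zp Tz; have : z = y \/ z = c.
    by apply/Lp; [rewrite -rcons_cons mem_rcons inE zp orbT|apply: TLv].
  by move=> [e|e]; [apply: (Ty); rewrite -e|rewrite -e zp in cp].
move=> a p ap; have [[Ga pa up] p0 Lp] := ap.
have La : verts (add_leaf Tx Ty) a by apply/Lp; [exact: mem_head|left].
have Lb : verts (add_leaf Tx Ty) (last a p) by apply/Lp; [exact: mem_last|right].
case: La => [e|Ta]; first by right; rewrite e in ap *; apply: yb ap _.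
case: Lb => [e|Tb].
  left; have [rp rE] := TPath_rev ap; rewrite e in rp rE *.
  exact: yb rp rE.
suff /nT[] : TPath G T a p by [left; apply: tree_le_sub TL _|right; apply: tree_le_sub TL _].
split=> // z zp; split=> [/TLv/(Lp _ zp)//|[->//|->//]].
Qed.

(** The vertices of [p] become leaves one at a time. The last hypothesis survives each step with [y]
    in place of [x]: components only shrink, and their neighbours in the larger tree are [y] itself
    or lie below [x]. *)
Lemma extend_path T x p : normal_tree G T r -> finite_set (verts T) ->
  verts T x -> path (edge G) x p -> uniq p -> (forall z, z \in p -> ~ verts T z) ->
  (forall y w z, y \in p -> verts T z -> reach (delete G (verts T)) y w ->
    edge G w z -> tree_le T r z x) ->
  exists T', [/\ normal_tree G T' r, finite_set (verts T'), subgraph T T' &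
    verts T' (last x p)].
Proof.
elim: p T x => [|y p IH] T x nT fT Tx /=; first by exists T; split=> //; split.
move=> /andP[xy yp] /andP[ny up] nTp N.
have Ty : ~ verts T y by apply: nTp; rewrite mem_head.
have nL := add_leaf_normal Tx Ty nT xy (fun z w Tz yw => N y w z (mem_head _ _) Tz yw).
have TL := add_leaf_sub Tx Ty.
have [_ Lr _ _] := nL.
have [||||T' [nT' fT' LT' T'p]] := IH (add_leaf Tx Ty) y nL _ _ yp up.
- by rewrite finite_setU.
- by left.
- move=> z zp [e|]; first by rewrite -e zp in ny.
  by apply: nTp; rewrite inE zp orbT.
- move=> y' w z y'p [->|Tz] y'w wz.
    have Ly : verts (add_leaf Tx Ty) y by left.
    have [tL _ _ _] := nL; have [[_ cL] _] := tL.
    by have [q rq qy] := cL r y Lr Ly; exists q; split=> //; rewrite -qy mem_last.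
  apply/(add_leaf_le Tx Ty)/(N y' w) => //; first by rewrite inE y'p orbT.
  by apply: reach_sub y'w; apply: delete_subS => v; right.
by exists T'; split=> //; apply: subgraph_trans LT'.
Qed.

Lemma extend_vertex T u : normal_tree G T r -> finite_set (verts T) -> verts G u ->
  exists T', [/\ normal_tree G T' r, finite_set (verts T'), subgraph T T' &
    verts T' u].
Proof.
move=> nT fT Gu; have [Tu|nTu] := pselect (verts T u).
  by exists T; split=> //; split.
have [tT Tr TG cmpT] := nT; have [TGv TGe] := TG.
set D := delete G (verts T).
pose N := [set x | verts T x /\ exists2 w, reach D u w & edge G w x].
(* Follow a path from [u] to the root: it must leave the component of [u] through an edge into
   [T]. *)
have [x0 Nx0] : N !=set0.
  have : reach D u r \/ N !=set0.
    have [_ /(_ u r Gu (TGv _ Tr))/linkedP ur] := connG.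
    apply: (@reach_ind V G (fun v => reach D u v \/ N !=set0) _ _ ur).
      by left; apply: reach0.
    move=> v v' vv' [uv|]; last by right.
    have [Tv'|nTv'] := pselect (verts T v').
      by right; exists v'; split=> //; exists v.
    left; apply/(reach_trans uv)/reach1/delete_edge => //.
    by have [] := reach_vertsr uv.
  by move=> [/reach_vertsr[]|].
(* Take [x] of maximal height in [N]; heights are bounded because [T] is finite. *)
have [x [Tx [w uw wx]] xmax] : exists2 x, N x &
    forall z, N z -> size (tpath T r z) <= size (tpath T r x).
  have /finite_seqP[s sE] := fT.
  pose P n := `[< exists2 x, N x & size (tpath T r x) = n >].
  have exP : exists n, P n by exists (size (tpath T r x0)); apply/asboolP; exists x0.
  have leP n : P n -> n <= \max_(z <- s) size (tpath T r z).
    move=> /asboolP[z [Tz _] <-]; apply: leq_bigmax_seq => //.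
    by move: Tz; rewrite sE.
  case: (ex_maxnP exP leP) => n /asboolP[x Nx <-] nmax.
  by exists x => // z Nz; apply: nmax; apply/asboolP; exists z.
(* Joining [z] to [x] through the component of [u] gives a [T]-path, so they are comparable, and [x]
   below [z] with maximal height forces equality. Thus [x] is the greatest element of [N]. *)
have top z w' : verts T z -> reach D u w' -> edge G w' z -> tree_le T r z x.
  move=> Tz uw' w'z; have [->|zx] := eqVneq z x.
    by have [rp px] := tpathP tT Tr Tx; exists (tpath T r x); split=> //;
      have := mem_last r (tpath T r x); rewrite px.
  have [q [Dw' w'q uq] qw] := reach_path (reach_trans (reach_sym uw') uw).
  have nTq v : v \in w' :: q -> ~ verts T v by move=> /(path_verts Dw' w'q)[].
  have Gq : path (edge G) w' q.
    by apply: sub_path w'q => a b; case: (delete_sub G (verts T)) => _; apply.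
  have /cmpT : TPath G T z (w' :: rcons q x).
    split=> //.
      split; first exact: TGv.
        by rewrite /= edge_sym w'z rcons_path Gq qw.
      rewrite -rcons_cons cons_uniq rcons_uniq uq andbT mem_rcons inE negb_or zx.
      by apply/andP; split; apply/negP => /nTq; apply.
    move=> v; rewrite /= last_rcons inE -rcons_cons mem_rcons inE => vq.
    split=> [Tv|[->|->]//]; move: vq => /or3P[/eqP|/eqP|/nTq//]; [by left|by right].
  rewrite /= last_rcons => -[//|/(tree_le_prefix tT Tr) xz].
  case/eqP: zx; have [_ <-] := tpathP tT Tr Tz; have [_ <-] := tpathP tT Tr Tx.
  move: (xmax z (conj Tz (ex_intro2 _ _ w' uw' w'z))) (xz).
  by rewrite prefixE => le /eqP <-; rewrite take_oversize.
have [q [Dw wq uq] qu] := reach_path (reach_sym uw).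
have nTq v : v \in w :: q -> ~ verts T v by move=> /(path_verts Dw wq)[].
have [||||T' [nT' fT' TT' T'u]] := @extend_path T x (w :: q) nT fT Tx.
- rewrite /= edge_sym wx; apply: sub_path wq => a b.
  by case: (delete_sub G (verts T)) => _; apply.
- by [].
- by [].
- move=> y w' z yq Tz yw'; apply: top Tz _; apply: reach_trans uw _.
  exact: reach_trans (path_reach Dw wq yq) yw'.
by exists T'; split=> //; rewrite -qu.
Qed.

End Extension.

(** * Increasing unions of normal trees *)

Definition single_graph (V : choiceType) (r : V) : sgraph V.
Proof. by exists [set r] (fun _ _ => false). Defined.

Lemma single_graph_normal (V : choiceType) (G : sgraph V) r : verts G r ->
  normal_tree G (single_graph r) r.
Proof.
move=> Gr; split=> //.
- split; first by split=> [|x y -> ->]; [exists r|exists [::]].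
  by move=> [|x [|y c]].
- by split=> // x ->.
- move=> x p [_ _ Tp]; left.
  have /= -> : verts (single_graph r) (last x p) by apply/(Tp _ (mem_last _ _)); right.
  have /= -> : verts (single_graph r) x by apply/(Tp _ (mem_head _ _)); left.
  by exists [::]; split; [split| |exact: mem_head].
Qed.

Section Union.
Variables (V : choiceType) (T_ : nat -> sgraph V).
Hypothesis T_S : forall n, subgraph (T_ n) (T_ n.+1).

Definition union_graph : sgraph V.
Proof.
exists (\bigcup_n verts (T_ n)) (fun u v => `[< exists n, edge (T_ n) u v >]).
- by move=> u v; apply/asboolP/asboolP => -[n]; rewrite edge_sym; exists n.
- by move=> u; apply/asboolP => -[n]; rewrite edge_irr.
- by move=> u v /asboolP[n uv]; exists n => //; apply: edge_verts uv.
Defined.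

Lemma union_mono n m : n <= m -> subgraph (T_ n) (T_ m).
Proof.
move=> /subnKC<-; elim: (m - n) => [|k IH]; first by rewrite addn0; split.
by apply: subgraph_trans IH _; rewrite addnS.
Qed.

Lemma union_sub n : subgraph (T_ n) union_graph.
Proof. by split=> [x Tx|u v uv]; [exists n|apply/asboolP; exists n]. Qed.

Lemma union_path x p : path (edge union_graph) x p ->
  exists n, path (edge (T_ n)) x p.
Proof.
elim: p x => [|y p IH] x /=; first by exists 0.
move=> /andP[/asboolP[n xy] /IH[m yp]]; exists (maxn n m).
rewrite (proj2 (union_mono (leq_maxl n m)) _ _ xy) /=.
by apply: sub_path yp => u v; apply: (proj2 (union_mono (leq_maxr n m))).
Qed.

(** Each requirement concerns finitely many vertices and edges, which all occur at one stage; a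
    [T]-path of the union is one for any stage containing its ends. *)
Lemma union_normal G r : (forall n, normal_tree G (T_ n) r) ->
  normal_tree G union_graph r.
Proof.
move=> nT; have [[[T0 _] _] T0r T0G _] := nT 0.
have common x y : verts union_graph x -> verts union_graph y ->
    exists2 n, verts (T_ n) x & verts (T_ n) y.
  move=> [n _ nx] [m _ my]; exists (maxn n m).
    exact: (proj1 (union_mono (leq_maxl n m))).
  exact: (proj1 (union_mono (leq_maxr n m))).
split.
- split; first split.
  + by exists r, 0.
  + move=> x y Ux Uy; have [n Tx Ty] := common x y Ux Uy.
    have [[[_ cT] _] _ _ _] := nT n.
    by apply/linkedP/(reach_sub (union_sub n))/linkedP/cT.
  + move=> [//|x c] c2 /andP[/union_path[n cn] uc].
    by have [[_ aT] _ _ _] := nT n; apply: (aT (x :: c)) => //; apply/andP.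
- by exists 0.
- split=> [x [n _]|u v /asboolP[n]].
    by have [_ _ [+ _] _] := nT n; apply.
  by have [_ _ [_ +] _] := nT n; apply.
- move=> x p [pp p0 Tp].
  have [||n Tx Ty] := common x (last x p).
  + by apply/(Tp _ (mem_head _ _)); left.
  + by apply/(Tp _ (mem_last _ _)); right.
  have [_ _ _ cmp] := nT n.
  suff /cmp[] : TPath G (T_ n) x p.
    by left; apply: tree_le_sub (union_sub n) _.
    by right; apply: tree_le_sub (union_sub n) _.
  split=> // z zp; split=> [Tz|[->|->]//].
  by apply/(Tp z zp); exists n.
Qed.

End Union.

Lemma countable_normal_tree (V : choiceType) (G : sgraph V) (U : set V) :
  gconnected G -> countable U -> U `<=` verts G ->
  exists T r, [/\ normal_tree G T r, countable (verts T) & U `<=` verts T].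
Proof.
move=> cG /countable_injP[f finj] UG; have [[r Gr] _] := cG.
(* Enumerates [U] along the injection [f]; numbers outside its image give the root, which is
   harmless to add. *)
pose u n := xget r [set v | U v /\ f v = n].
have Gu n : verts G (u n) by rewrite /u; case: xgetP => [v _ []/UG|].
have uE v : U v -> u (f v) = v.
  move=> Uv; rewrite /u; apply: xget_unique => // v' [Uv' e].
  by apply: finj; rewrite ?inE.
pose Q T := normal_tree G T r /\ finite_set (verts T).
have step (x : sgraph V * nat) : exists T, Q x.1 ->
    [/\ Q T, subgraph x.1 T & verts T (u x.2)].
  have [[nT fT]|nQ] := pselect (Q x.1); last by exists x.1.
  by have [T [nT' fT' sub Tu]] := extend_vertex cG nT fT (Gu x.2); exists T.
have [g gP] := choice step.
(* Stage [n.+1] is the first required to contain [u n], which explains the successor of [f v] at the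
   end. *)
pose T_ := fix T_ n := if n is n.+1 then g (T_ n, n) else single_graph r.
have QT n : Q (T_ n).
  elim: n => [|n /(gP (_, n))[]//]; split; first exact: single_graph_normal.
  exact: finite_set1.
have T_S n : subgraph (T_ n) (T_ n.+1) by case: (gP (T_ n, n) (QT n)).
exists (union_graph T_), r; split.
- by apply: union_normal => // n; case: (QT n).
- apply: bigcup_countable; first exact: countableP.
  by move=> n _; apply: finite_set_countable; case: (QT n).
- move=> v Uv; exists (f v).+1 => //.
  by have [_ _ /=] := gP (_, f v) (QT (f v)); rewrite uE.
Qed.

(** * The implications between the assertions *)

Lemma second_countable_separable (X : topologicalType) :
  @second_countable X -> separable X.
Proof.
move=> [B cB [Bo Bb]].
(* The empty space is treated apart, as [f] needs a default point for empty members of the base. *)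
have [X0|/set0P[x0 _]] := eqVneq [set: X] set0.
  exists set0; first exact: countable0.
  by move=> O [x]; have : [set: X] x by []; rewrite X0.
pose f (U : set X) := xget x0 U.
exists (f @` B); first exact: sub_countable (card_image_le _ _) cB.
move=> O [x Ox] oO; have [U [BU Ux] UO] := Bb x O (open_nbhs_nbhs (conj oO Ox)).
exists (f U); split; last by exists U.
by apply: UO; rewrite /f; case: xgetP => // /(_ x).
Qed.

Lemma separable_normal_tree (V : choiceType) (G : sgraph V) : gconnected G ->
  separable (ends G) ->
  exists (T : sgraph V) (r : V) (TG : subgraph T G),
    [/\ normal_tree G T r, countable (verts T) & end_faithful TG].
Proof.
move=> cG [D cD dD].
have [ray_of rayP] := choice (@end_nonempty V G).
pose U := \bigcup_(w in D) range (ray_of w).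
have cU : countable U.
  apply: bigcup_countable => // w _.
  exact: sub_countable (card_image_le _ _) (countableP _).
have UG : U `<=` verts G.
  by move=> x [w _ [n _ <-]]; apply: ray_vert (end_ray (rayP w)).
have [T [r [nT cT UT]]] := countable_normal_tree cG cU UG.
have [_ _ TG _] := nT; exists T, r, TG; split=> //.
apply: (end_meets_faithful nT) => w Y YG fY.
have [cC _] := end_compP w fY.
(* Density gives [d] in [D] with C(Y, d) = C(Y, w). The ray chosen for [d] runs inside [T] and has a
   tail in this component. *)
have [||d [/= dY Dd]] := dD (end_nbhd G Y (end_comp Y w)); first by exists w.
  by apply: (proj1 (basic_open_basis G)); exists Y, (end_comp Y w).
have [n dn] := end_comp_tail fY (rayP d).
exists (ray_of d n); first by apply: UT; exists d.
by rewrite -dY; apply: dn.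
Qed.

Theorem theorem4p2 (V : choiceType) (G : sgraph V) (connG : gconnected G) :
  [<-> @second_countable (ends G);
       separable (ends G);
       exists (T : sgraph V) (r : V) (TG : subgraph T G),
         [/\ normal_tree G T r, countable (verts T) & end_faithful TG];
       exists B : set (set (ends G)),
         [/\ countable B, basis B & (B `<=` basic_open G)%classic]].
Proof.
tfae.
- exact: second_countable_separable.
- exact: separable_normal_tree.
- move=> [T [r [TG [nT cT eT]]]]; exists (@tree_base V G T r); split.
  + exact: countable_tree_base.
  + exact: tree_base_basis nT _ eT.
  + exact: tree_base_basic.
- by move=> [B [cB bB _]]; exists B.
Qed.
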